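(* Let $E$ be a countably Dedekind complete Riesz space, let $V$ be a countably chain complete subset of $E$ (with the order inherited from $E$), and let $S$ be an order preserving self-map on $V$. If $S$ is absolutely order contracting on $V$, then $S$ has a unique fixed point $\bar v$ in $V$, and $S^n v \stackrel{o}{\to} \bar v$ for any $v \in V$.
   Context: For elements $v \le w$ of a poset, $[v,w]=\{u : v\le u\le w\}$ is an order interval. A chain is a totally ordered subset. A poset $V$ is countably chain complete if it is order bounded (i.e. $V$ itself is an order interval $[a,b]$ with $a,b\in V$) and every countable chain in $V$ has a supremum and an infimum in $V$. A poset is countably Dedekind complete if every order interval in it is countably chain complete. Write $v_n\uparrow v$ if $(v_n)$ is increasing with supremum $v$, and $v_n\downarrow v$ if it is decreasing with infimum $v$. A self-map $S$ is order preserving if $v\le w$ implies $Sv\le Sw$. A self-map $K$ on $E$ is order continuous if $v_n\uparrow v$ in $E$ implies that $\bigvee_n Kv_n$ exists and $Kv_n\uparrow Kv$. A sequence $(v_n)$ in $E$ order converges to $v\in E$, written $v_n\stackrel{o}{\to}v$, if there is a sequence $d_n\downarrow 0$ in $E$ with $|v_n-v|\le d_n$ for all $n\in\mathbb N$. A self-map $S$ on $V\subset E$ is absolutely order contracting on $V$ if there exists an order continuous linear operator $K:E\to E$ such that, for all $v,w\in V$, $|Sv-Sw|\le K|v-w|$ and $K^n|v-w|\stackrel{o}{\to}0$. *)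

(* Defs.v *)
From HB Require Import structures.
From mathcomp Require Import all_boot all_order all_algebra.
From mathcomp Require Import boolp classical_sets functions cardinality reals.

Set Implicit Arguments.
Unset Strict Implicit.
Unset Printing Implicit Defensive.

Import Order.TTheory GRing.Theory Num.Theory.
Local Open Scope classical_set_scope.
Local Open Scope ring_scope.

Section Posets.
Context {d : Order.disp_t} {T : porderType d}.
Implicit Types V C : set T.

Definition order_interval (v w : T) : set T := [set u | (v <= u <= w)%O].

(* Suprema and infima in V are taken in the order that V inherits from T:
   they are least (greatest) among the bounds lying in V, and need not be
   suprema or infima in T. *)
Definition is_sup_in V C (s : T) :=
  (V `&` ubound C) s /\ lbound (V `&` ubound C) s.

Definition is_inf_in V C (s : T) :=
  (V `&` lbound C) s /\ ubound (V `&` lbound C) s.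

Definition chain C := total_on C (fun x y : T => (x <= y)%O).

Definition countably_chain_complete V :=
  (exists a b, [/\ V a, V b & V = V `&` order_interval a b]) /\
  (forall C, C `<=` V -> countable C -> chain C ->
     (exists s, is_sup_in V C s) /\ (exists i, is_inf_in V C i)).

Definition increases_to (u_ : nat -> T) (u : T) :=
  {homo u_ : n m / (n <= m)%N >-> (n <= m)%O} /\ is_sup_in setT (range u_) u.

Definition decreases_to (u_ : nat -> T) (u : T) :=
  {homo u_ : n m / (n <= m)%N >-> (m <= n)%O} /\ is_inf_in setT (range u_) u.

Definition order_continuous (K : T -> T) :=
  forall (u_ : nat -> T) u, increases_to u_ u -> increases_to (fun n => K (u_ n)) (K u).

Definition order_preserving_on V (S : T -> T) :=
  forall v w, V v -> V w -> (v <= w)%O -> (S v <= S w)%O.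

End Posets.

Definition countably_Dedekind_complete {d : Order.disp_t} (T : porderType d) :=
  forall v w : T, (v <= w)%O -> countably_chain_complete (order_interval v w).

(* The lattice operations are fields of the mixin, specified as binary suprema
   and infima (the specification of lexI and leUx), because Order.Lattice
   cannot be joined with GRing.Lmodule once Num.RealDomain is declared. *)
HB.mixin Record isRieszSpace (R : realType) E
    of GRing.Lmodule R E & Num.POrderedZmodule E := {
  rjoin : E -> E -> E;
  rmeet : E -> E -> E;
  rjoin_le : forall x y z : E, (rjoin x y <= z) = (x <= z) && (y <= z);
  le_rmeet : forall x y z : E, (z <= rmeet x y) = (z <= x) && (z <= y);
  riesz_leD2r : forall z x y : E, x <= y -> x + z <= y + z;
  riesz_scale_ge0 : forall (a : R) (x : E), 0 <= a -> 0 <= x -> 0 <= a *: x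
}.

#[short(type="rieszType")]
HB.structure Definition RieszSpace (R : realType) :=
  { E of isRieszSpace R E & GRing.Lmodule R E & Num.POrderedZmodule E }.

Section RieszSpaces.
Context {R : realType} {E : rieszType R}.

(* The modulus; it is not the real-valued norm of the library. *)
Definition modulus (x : E) : E := rjoin x (- x).

Definition order_cvg (v_ : nat -> E) (v : E) :=
  exists2 d_ : nat -> E,
    decreases_to d_ 0 & forall n, modulus (v_ n - v) <= d_ n.

(* S is total on E, but only its values on V matter. *)
Definition absolutely_order_contracting (V : set E) (S : E -> E) :=
  exists2 K : {linear E -> E}, order_continuous K &
    forall v w, V v -> V w ->
      modulus (S v - S w) <= K (modulus (v - w)) /\
      order_cvg (fun n => iter n K (modulus (v - w))) 0.

End RieszSpaces.

(* Main.v *)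
(** Let [a] and [b] be the least and greatest elements of [V].  The sequence
    [S^n a] increases, [S^n b] decreases, and the supremum [s] in [V] of the
    chain of the [S^n a] lies between them, as does [S s] from the index [1] on.
    The gap [S^n b - S^n a] is at most [K^n |b - a|], which order converges to
    [0]; so [S s = s], and every orbit in [V], being squeezed between the two
    sequences, order converges to [s]. *)
Require Import Defs.
From HB Require Import structures.
From mathcomp Require Import all_boot all_order all_algebra.
From mathcomp Require Import boolp classical_sets functions cardinality reals.

Local Open Scope classical_set_scope.
Local Open Scope ring_scope.

Import Order.TTheory GRing.Theory Num.Theory.

(** For [x <= y] the sequence [x, y, y, ...] increases to [y], so its image under [K] is increasing;
    its first two terms are [K x] and [K y]. *)
Lemma order_continuous_homo d (T : porderType d) (K : T -> T) :
  order_continuous K -> {homo K : x y / (x <= y)%O}.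
Proof.
move=> Kcont x y lexy.
pose u n := if n is 0 then x else y.
have [] : increases_to (fun n => K (u n)) (K y).
  apply: Kcont; split; first by case=> [|n] [|m].
  split; [split=> // _ [[|n] _ <-] //|].
  by move=> z [_]; apply; exists 1.
by move=> /(_ 0 1 isT).
Qed.

Lemma iter_set_fun T (V : set T) (S : T -> T) n :
  set_fun V V S -> set_fun V V (iter n S).
Proof. by move=> S_self v Vv; elim: n => //= n; apply: S_self. Qed.

Section IterateOn.
Context {d : Order.disp_t} {T : porderType d} {V : set T} {S : T -> T}.
Hypotheses (S_self : set_fun V V S) (S_mono : order_preserving_on V S).

Lemma iter_mono n : order_preserving_on V (iter n S).
Proof.
move=> v w Vv Vw levw; elim: n => //= n.
by apply: S_mono; exact: iter_set_fun.
Qed.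

(** For [n <= m], [S^m a] is [S^n] applied to [S^(m-n) a], a point of [V] and hence above [a]. *)
Lemma iter_least_homo a : V a -> (forall v, V v -> (a <= v)%O) ->
  {homo (fun n => iter n S a) : n m / (n <= m)%N >-> (n <= m)%O}.
Proof.
move=> Va a_le n m /subnKC <-; rewrite iterD.
by apply: iter_mono => //; [exact: iter_set_fun | by apply: a_le; exact: iter_set_fun].
Qed.

Lemma iter_greatest_homo b : V b -> (forall v, V v -> (v <= b)%O) ->
  {homo (fun n => iter n S b) : n m / (n <= m)%N >-> (m <= n)%O}.
Proof.
move=> Vb le_b n m /subnKC <-; rewrite iterD.
by apply: iter_mono => //; [exact: iter_set_fun | by apply: le_b; exact: iter_set_fun].
Qed.

End IterateOn.

Section RieszSpaceLemmas.
Context {R : realType} {E : rieszType R}.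
Implicit Types x y z : E.

Lemma riesz_leBl x y z : x <= y -> x - z <= y - z.
Proof. exact: riesz_leD2r. Qed.

Lemma riesz_leBr x y z : x <= y -> z - y <= z - x.
Proof.
move=> /(riesz_leD2r (z - x - y)).
by rewrite subrKC addrA subrKC.
Qed.

Lemma riesz_leB x y z t : x <= y -> z <= t -> x - t <= y - z.
Proof.
by move=> lexy lezt; apply: le_trans (riesz_leBl _ _ t lexy) (riesz_leBr _ _ y lezt).
Qed.

Lemma riesz_subr_le0 x y : x - y <= 0 -> x <= y.
Proof. by move=> /(riesz_leD2r y); rewrite subrK add0r. Qed.

Lemma modulus_le x y : (modulus x <= y) = (x <= y) && (- x <= y).
Proof. exact: rjoin_le. Qed.

Lemma le_modulus x : x <= modulus x.
Proof. by have := lexx (modulus x); rewrite modulus_le => /andP[]. Qed.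

Lemma decreases_to0_le0 (d_ : nat -> E) x :
  decreases_to d_ 0 -> (forall n, x <= d_ n) -> x <= 0.
Proof. by move=> [_ [_ d_glb]] led; apply: d_glb; split=> // _ [n _ <-]. Qed.

(** By induction: one contraction step at the [n]-th iterates, which stay in [V], then [K] applied
    to the bound already obtained. *)
Lemma contracting_iter_le (V : set E) (S K : E -> E) :
  set_fun V V S -> {homo K : x y / x <= y} ->
  (forall v w, V v -> V w -> modulus (S v - S w) <= K (modulus (v - w))) ->
  forall n v w, V v -> V w ->
    modulus (iter n S v - iter n S w) <= iter n K (modulus (v - w)).
Proof.
move=> S_self K_homo SK n v w Vv Vw; elim: n => //= n IHn.
by apply: le_trans (SK _ _ _ _) (K_homo _ _ IHn); exact: iter_set_fun.
Qed.

End RieszSpaceLemmas.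

Theorem theorem4p4 (R : realType) (E : rieszType R)
    (E_complete : countably_Dedekind_complete E)
    (V : set E) (V_complete : countably_chain_complete V)
    (S : E -> E) (S_self : set_fun V V S)
    (S_mono : order_preserving_on V S)
    (S_contr : absolutely_order_contracting V S) :
  exists vbar : E,
    unique (fun v => V v /\ S v = v) vbar /\
    (forall v, V v -> order_cvg (fun n => iter n S v) vbar).
Proof.
case: S_contr => K K_cont SK.
case: V_complete => -[a [b [Va Vb V_ab]]] V_chain.
have a_le v : V v -> a <= v by rewrite V_ab => -[_ /andP[]].
have le_b v : V v -> v <= b by rewrite V_ab => -[_ /andP[]].
have it_a n v : V v -> iter n S a <= iter n S v.
  by move=> Vv; apply: (iter_mono S_self S_mono) => //; exact: a_le.
have it_b n v : V v -> iter n S v <= iter n S b.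
  by move=> Vv; apply: (iter_mono S_self S_mono) => //; exact: le_b.
have a_homo := iter_least_homo S_self S_mono a Va a_le.
have b_homo := iter_greatest_homo S_self S_mono b Vb le_b.
have [d_ d_to0 gap_d] : exists2 d_ : nat -> E, decreases_to d_ 0 &
    forall n, iter n S b - iter n S a <= d_ n.
  have [_ [d_ d_to0 Kd]] := SK b a Vb Va.
  exists d_ => // n; apply: le_trans (le_modulus _) _.
  apply: le_trans (contracting_iter_le V S K S_self _ _ n b a Vb Va) _.
  - exact: order_continuous_homo.
  - by move=> v w Vv Vw; have [] := SK v w Vv Vw.
  - by apply: le_trans (Kd n); rewrite subr0; exact: le_modulus.
(* Here [x - y <= S^n b - S^n a <= d_ n] for every [n], and [d_] has infimum [0]. *)
have squeeze x y :
    (forall n, x <= iter n S b) -> (forall n, iter n S a <= y) -> x <= y.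
  move=> x_le le_y; apply/riesz_subr_le0/(decreases_to0_le0 d_) => // n.
  by apply: le_trans (gap_d n); apply: riesz_leB.
have [[s [[Vs s_ub] s_lub]] _] :
    (exists s, is_sup_in V (range (fun n => iter n S a)) s) /\
    (exists i, is_inf_in V (range (fun n => iter n S a)) i).
  apply: V_chain.
  - by move=> _ [n _ <-]; exact: iter_set_fun.
  - exact: card_image_le.
  - move=> _ _ [n _ <-] [m _ <-].
    by case/orP: (leq_total n m) => /a_homo; [left | right].
have a_le_s n : iter n S a <= s by apply: s_ub; exists n.
have s_le_b n : s <= iter n S b.
  (* [s] is least only among the upper bounds lying in [V], so [S^n b] must be shown to be in [V] as
     well. *)
  apply: s_lub; split; first exact: iter_set_fun.
  move=> _ [m _ <-].
  (* The indices [m] and [n] are unrelated; both sequences are compared at [maxn m n]. *)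
  apply: le_trans (a_homo _ _ (leq_maxl m n)) _.
  exact: le_trans (it_a _ _ Vb) (b_homo _ _ (leq_maxr m n)).
have Sfix : S s = s.
  (* Applying [S] to the bounds on [s] gives bounds at index [n.+1]; monotonicity of the two
     sequences brings them back to [n]. *)
  apply/le_anti/andP; split; apply: squeeze => // n.
  - apply: le_trans (b_homo _ _ (leqnSn n)).
    by apply: (S_mono s (iter n S b)) => //; exact: iter_set_fun.
  - apply: le_trans (a_homo _ _ (leqnSn n)) _.
    by apply: (S_mono (iter n S a) s) => //; exact: iter_set_fun.
exists s; split.
  split=> // v [Vv Sv].
  have itv n : iter n S v = v by elim: n => //= n ->.
  (* Being its own orbit, [v] lies between [S^n a] and [S^n b] for all [n], as [s] does. *)
  apply/le_anti/andP; split; apply: squeeze => // n; rewrite -(itv n).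
  - exact: it_a.
  - exact: it_b.
(* The same [d_] serves every [v]: [S^n v] and [s] both lie between [S^n a] and [S^n b], so either
   difference is at most the gap. *)
move=> v Vv; exists d_ => // n.
rewrite modulus_le opprB; apply/andP; split; apply: le_trans (gap_d n).
- by apply: riesz_leB => //; exact: it_b.
- by apply: riesz_leB => //; exact: it_a.
Qed.
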